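(* Let $(A,\sigma)$ be a Hermitian algebra, $G=\mathrm{Sp}_2(A_\mathbb{C},\sigma_\mathbb{C})$, and let $\mathfrak{C}_G$ be the space of quaternionic structures on $A_\mathbb{C}^2$. For $J\in\mathfrak{C}_G$, the tangent space of $\mathfrak{C}_G$ at $J$ is the set $T_J\mathfrak{C}_G$ of all additive maps $L\colon A_\mathbb{C}^2\to A_\mathbb{C}^2$ such that $L(xa)=L(x)\bar a$ for all $x\in A_\mathbb{C}^2$, $a\in A_\mathbb{C}$; $h_L$ is $\bar\sigma_\mathbb{C}$-symmetric; and $LJ+JL=0$. The group $\mathrm{Sp}_2(A_\mathbb{C},\sigma_\mathbb{C})$ acts on $T\mathfrak{C}_G$ by conjugation, i.e. $g.(J,L)=(gJg^{-1},gLg^{-1})$. In particular, $T_{gJg^{-1}}\mathfrak{C}_G=g\,T_J\mathfrak{C}_G\,g^{-1}$.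
   Context: $A$ is a unital associative, possibly noncommutative, finite-dimensional semisimple $\mathbb{R}$-algebra and $\sigma\colon A\to A$ is an anti-involution: $\mathbb{R}$-linear, $\sigma(ab)=\sigma(b)\sigma(a)$, $\sigma^2=\mathrm{Id}$. For any involutive algebra $(B,\tau)$ put $B^\tau=\{a\in B\mid\tau(a)=a\}$, $B^\times$ the group of invertible elements, $\mathrm{O}(B,\tau)=\{a\in B^\times\mid \tau(a)=a^{-1}\}$, $B^\tau_+=\{a^2\mid a\in B^\tau\cap B^\times\}$, $B^\tau_{\ge 0}=\{a^2\mid a\in B^\tau\}$. The pair $(A,\sigma)$ is Hermitian if for $x,y\in A^\sigma$, $x^2+y^2=0$ implies $x=y=0$; as standing properties of Hermitian algebras, $A^\sigma_+$ and $A^\sigma_{\ge0}$ are proper convex cones in $A^\sigma$, $\mathrm{O}(A,\sigma)$ is compact, and $x\mapsto ax\sigma(a)$ preserves $A^\sigma_+$ and $A^\sigma_{\geq 0}$ for every $a\in A^\times$. $A_\mathbb{C}=A\otimes_\mathbb{R}\mathbb{C}$ with complex conjugation $a\mapsto\bar a$; $\sigma_\mathbb{C}$ and $\bar\sigma_\mathbb{C}$ are the $\mathbb{C}$-linear and $\mathbb{C}$-antilinear extensions of $\sigma$; $(A_\mathbb{C},\bar\sigma_\mathbb{C})$ is again Hermitian. $A_\mathbb{C}^2$ is the right $A_\mathbb{C}$-module of columns; $x\in A_\mathbb{C}^2$ is regular if there is $y$ such that $(a,b)\mapsto xa+yb$ is an isomorphism $A_\mathbb{C}^2\to A_\mathbb{C}^2$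 of right $A_\mathbb{C}$-modules. Let $\omega_\mathbb{C}(x,y)=\sigma_\mathbb{C}(x)^t\begin{pmatrix}0&1\\-1&0\end{pmatrix}y$; $\mathrm{Sp}_2(A_\mathbb{C},\sigma_\mathbb{C})$ is the group of $A_\mathbb{C}$-linear automorphisms of $A_\mathbb{C}^2$ preserving $\omega_\mathbb{C}$. For an additive map $L$ with $L(xa)=L(x)\bar a$ put $h_L(x,y)=\omega_\mathbb{C}(L(x),y)$; it satisfies $h_L(xr_1,yr_2)=\bar\sigma_\mathbb{C}(r_1)h_L(x,y)r_2$. Such a form $b$ is $\bar\sigma_\mathbb{C}$-symmetric if $b(x,y)=\bar\sigma_\mathbb{C}(b(y,x))$ for all $x,y$; it is a $\bar\sigma_\mathbb{C}$-inner product if moreover for all regular $x$, $b(x,x)\in (A_\mathbb{C}^{\bar\sigma_\mathbb{C}})_{\geq0}$, with $b(x,x)=0$ if and only if $x=0$. A quaternionic structure on $A_\mathbb{C}^2$ is an additive map $J\colon A_\mathbb{C}^2\to A_\mathbb{C}^2$ with $J^2=-\mathrm{Id}$ and $J(xa)=J(x)\bar a$ for all $x\in A_\mathbb{C}^2$, $a\in A_\mathbb{C}$; $\mathfrak{C}_G$ is the set of quaternionic structures $J$ for which $h_J$ is a $\bar\sigma_\mathbb{C}$-inner product. It is a smooth manifold on which $G$ acts smoothly and transitively by conjugation, and tangent vectors are regarded as elements of the real vector space of additive maps $L$ with $L(xa)=L(x)\bar a$. *)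

(* Defs.v *)
From HB Require Import structures.
From mathcomp Require Import all_boot all_order all_algebra all_field.
From mathcomp Require Import complex.
From mathcomp Require Import all_classical all_reals all_analysis.

Set Implicit Arguments.
Unset Strict Implicit.
Unset Printing Implicit Defensive.

Import Order.TTheory GRing.Theory Num.Theory.
Import numFieldNormedType.Exports.

Local Open Scope classical_set_scope.
Local Open Scope ring_scope.

Section Involutions.
Variables (B : nzRingType) (tau : B -> B).

Definition symmetric_elements : set B := [set a | tau a = a].

Definition nonneg_elements : set B := [set a ^+ 2 | a in symmetric_elements].

Definition hermitian : Prop :=
  forall x y, symmetric_elements x -> symmetric_elements y ->
    x ^+ 2 + y ^+ 2 = 0 -> x = 0 /\ y = 0.

End Involutions.

Section Algebras.
Variables (R : realType) (A : falgType R).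

Definition anti_involution (sigma : A -> A) : Prop :=
  [/\ linear sigma,
      (forall a b, sigma (a * b) = sigma b * sigma a)
    & involutive sigma].

Definition left_ideal (U : {vspace A}) : Prop :=
  forall a u, u \in U -> a * u \in U.

(* A is semisimple as a left module over itself. Left ideals of a unital
   algebra are subspaces, so quantifying over {vspace A} loses nothing. *)
Definition semisimple_algebra : Prop :=
  forall U : {vspace A}, left_ideal U ->
    exists W : {vspace A},
      [/\ left_ideal W, (U + W)%VS = fullv & (U :&: W)%VS = 0%VS].

Definition hermitian_algebra (sigma : A -> A) : Prop :=
  [/\ semisimple_algebra, anti_involution sigma & hermitian sigma].

End Algebras.

(* The tensor product of A with R[i]: Cplx a b stands for
   a (x) 1 + b (x) i. *)
Record complexification (R : realType) (A : falgType R) :=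
  Cplx { cre : A; cim : A }.

Section Complexification.
Variables (R : realType) (A : falgType R).
Local Notation AC := (complexification A).

Let code (u : AC) : A * A := (cre u, cim u).
Let decode (p : A * A) : AC := Cplx p.1 p.2.

Fact codeK : cancel code decode. Proof. by case. Qed.
HB.instance Definition _ := Choice.copy AC (can_type codeK).

Lemma cplx_eq (u v : AC) : cre u = cre v -> cim u = cim v -> u = v.
Proof. by case: u => a b; case: v => c d /= -> ->. Qed.

Definition cplx_add (u v : AC) : AC := Cplx (cre u + cre v) (cim u + cim v).
Definition cplx_opp (u : AC) : AC := Cplx (- cre u) (- cim u).

Fact cplx_addA : associative cplx_add.
Proof. by move=> u v w; apply: cplx_eq; rewrite /= addrA. Qed.
Fact cplx_addC : commutative cplx_add.
Proof. by move=> u v; apply: cplx_eq; rewrite /= addrC. Qed.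
Fact cplx_add0 : left_id (Cplx 0 0) cplx_add.
Proof. by move=> u; apply: cplx_eq; rewrite /= add0r. Qed.
Fact cplx_addN : left_inverse (Cplx 0 0) cplx_opp cplx_add.
Proof. by move=> u; apply: cplx_eq; rewrite /= addNr. Qed.

HB.instance Definition _ :=
  GRing.isZmodule.Build AC cplx_addA cplx_addC cplx_add0 cplx_addN.

Definition cplx_mul (u v : AC) : AC :=
  Cplx (cre u * cre v - cim u * cim v) (cre u * cim v + cim u * cre v).

Fact cplx_mulA : associative cplx_mul.
Proof.
move=> u v w; apply: cplx_eq;
  rewrite /= !(mulrDl, mulrDr, mulNr, mulrN, opprD, mulrA, addrA);
  by rewrite [LHS](ACl (1*4*2*3)).
Qed.
Fact cplx_mul1 : left_id (Cplx 1 0) cplx_mul.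
Proof.
by move=> u; apply: cplx_eq; rewrite /= !mul1r !mul0r ?subr0 ?addr0.
Qed.
Fact cplx_mulr1 : right_id (Cplx 1 0) cplx_mul.
Proof.
by move=> u; apply: cplx_eq; rewrite /= !mulr1 !mulr0 ?subr0 ?add0r.
Qed.
Fact cplx_mulDl : left_distributive cplx_mul +%R.
Proof.
move=> u v w; apply: cplx_eq; rewrite /= !mulrDl ?opprD !addrA;
  by rewrite [LHS](ACl (1*3*2*4)).
Qed.
Fact cplx_mulDr : right_distributive cplx_mul +%R.
Proof.
move=> u v w; apply: cplx_eq; rewrite /= !mulrDr ?opprD !addrA;
  by rewrite [LHS](ACl (1*3*2*4)).
Qed.
Fact cplx_1neq0 : Cplx 1 0 != 0 :> AC.
Proof. by apply/eqP => -[/eqP]; rewrite oner_eq0. Qed.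

HB.instance Definition _ := GRing.Zmodule_isNzRing.Build AC
  cplx_mulA cplx_mul1 cplx_mulr1 cplx_mulDl cplx_mulDr cplx_1neq0.

Definition cplx_scale (z : R[i]) (u : AC) : AC :=
  Cplx (complex.Re z *: cre u - complex.Im z *: cim u)
       (complex.Re z *: cim u + complex.Im z *: cre u).

Fact cplx_scaleA z w u :
  cplx_scale z (cplx_scale w u) = cplx_scale (z * w) u.
Proof.
case: z w => a b [c d]; apply: cplx_eq;
  rewrite /= !(scalerDl, scalerDr, scaleNr, scalerN, scalerA, opprD, addrA);
  by rewrite [LHS](ACl (1*4*2*3)).
Qed.
Fact cplx_scale1 : left_id 1 cplx_scale.
Proof.
by move=> u; apply: cplx_eq; rewrite /= !scale1r !scale0r ?subr0 ?addr0.
Qed.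
Fact cplx_scaleDr : right_distributive cplx_scale +%R.
Proof.
move=> z u v; apply: cplx_eq; rewrite /= !scalerDr ?opprD !addrA;
  by rewrite [LHS](ACl (1*3*2*4)).
Qed.
Fact cplx_scaleDl u : {morph cplx_scale^~ u : z w / z + w}.
Proof.
move=> [a b] [c d]; apply: cplx_eq; rewrite /= !scalerDl ?opprD !addrA;
  by rewrite [LHS](ACl (1*3*2*4)).
Qed.

HB.instance Definition _ := GRing.Zmodule_isLmodule.Build R[i] AC
  cplx_scaleA cplx_scale1 cplx_scaleDr cplx_scaleDl.

Fact cplx_scaleAl (z : R[i]) (u v : AC) : z *: (u * v) = (z *: u) * v.
Proof.
apply: cplx_eq; rewrite /= !(mulrDl, mulNr, scalerDr, scalerN, opprD, addrA)
  -!scalerAl; by rewrite [LHS](ACl (1*4*2*3)).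
Qed.
HB.instance Definition _ :=
  GRing.Lmodule_isLalgebra.Build R[i] AC cplx_scaleAl.

Fact cplx_scaleAr (z : R[i]) (u v : AC) : z *: (u * v) = u * (z *: v).
Proof.
apply: cplx_eq; rewrite /= !(mulrDr, mulrN, scalerDr, scalerN, opprD, addrA)
  -!scalerAr; by rewrite [LHS](ACl (1*3*2*4)).
Qed.
HB.instance Definition _ :=
  GRing.Lalgebra_isAlgebra.Build R[i] AC cplx_scaleAr.

Definition cconj (u : AC) : AC := Cplx (cre u) (- cim u).

Definition sigmaC (sigma : A -> A) (u : AC) : AC :=
  Cplx (sigma (cre u)) (sigma (cim u)).

Definition bar_sigmaC (sigma : A -> A) (u : AC) : AC :=
  Cplx (sigma (cre u)) (- sigma (cim u)).

(* Column vectors form a right module; the scalar multiplication of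
   matrices in the library acts on the left. *)
Definition rscale (x : 'cV[AC]_2) (a : AC) : 'cV[AC]_2 :=
  \col_i (x i 0 * a).

Definition right_linear (f : 'cV[AC]_2 -> 'cV[AC]_2) : Prop :=
  {morph f : x y / x + y} /\ forall x a, f (rscale x a) = rscale (f x) a.

Definition conj_linear (f : 'cV[AC]_2 -> 'cV[AC]_2) : Prop :=
  {morph f : x y / x + y} /\
  forall x a, f (rscale x a) = rscale (f x) (cconj a).

Definition regular_vector (x : 'cV[AC]_2) : Prop :=
  exists y, let f c := rscale x (c 0 0) + rscale y (c 1 0) in
            right_linear f /\ bijective f.

End Complexification.

Section Symplectic.
Variables (R : realType) (A : falgType R) (sigma : A -> A).
Local Notation AC := (complexification A).
Local Notation AC2 := ('cV[AC]_2).

Definition omega_mx : 'M[AC]_2 :=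
  \matrix_(i, j) (if (i < j)%N then 1 else if (j < i)%N then -1 else 0).

Definition omegaC (x y : AC2) : AC :=
  ((map_mx (sigmaC sigma) x)^T *m omega_mx *m y) 0 0.

Record Sp2 := MkSp2 {
  Sp2_fun :> AC2 -> AC2;
  Sp2_inv : AC2 -> AC2;
  Sp2_right_linear : right_linear Sp2_fun;
  Sp2_funK : cancel Sp2_fun Sp2_inv;
  Sp2_invK : cancel Sp2_inv Sp2_fun;
  Sp2_omega : forall x y, omegaC (Sp2_fun x) (Sp2_fun y) = omegaC x y
}.

HB.instance Definition _ := gen_eqMixin Sp2.
HB.instance Definition _ := gen_choiceMixin Sp2.

Lemma Sp2_eq (g h : Sp2) : g =1 h -> g = h.
Proof.
case: g h => g g' gl gK g'K go [h h' hl hK h'K ho] /= /funext gh.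
subst h; have e : g' = h'.
  by apply/funext => x; rewrite -{1}(h'K x) gK.
subst h'; congr MkSp2; exact: Prop_irrelevance.
Qed.

Program Definition Sp2_one : Sp2 := @MkSp2 id id _ _ _ _.
Next Obligation. by []. Qed.
Next Obligation. by []. Qed.
Next Obligation. by []. Qed.
Next Obligation. by []. Qed.

Program Definition Sp2_mul (g h : Sp2) : Sp2 :=
  @MkSp2 (g \o h) (Sp2_inv h \o Sp2_inv g) _ _ _ _.
Next Obligation.
move=> g h; case: (Sp2_right_linear g) (Sp2_right_linear h) => gD gZ [hD hZ].
by split=> [x y|x a] /=; rewrite ?hD ?gD ?hZ ?gZ.
Qed.
Next Obligation. by move=> g h x /=; rewrite !Sp2_funK. Qed.
Next Obligation. by move=> g h x /=; rewrite !Sp2_invK. Qed.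
Next Obligation. by move=> g h x y /=; rewrite !Sp2_omega. Qed.

Program Definition Sp2_inverse (g : Sp2) : Sp2 :=
  @MkSp2 (Sp2_inv g) g _ _ _ _.
Next Obligation.
move=> g; case: (Sp2_right_linear g) => gD gZ.
split=> [x y|x a]; apply: (can_inj (Sp2_funK g)).
  by rewrite gD !Sp2_invK.
by rewrite gZ !Sp2_invK.
Qed.
Next Obligation. by move=> g x; rewrite Sp2_invK. Qed.
Next Obligation. by move=> g x; rewrite Sp2_funK. Qed.
Next Obligation. by move=> g x y; rewrite -(Sp2_omega g) !Sp2_invK. Qed.

Fact Sp2_mulA : associative Sp2_mul.
Proof. by move=> g h k; apply: Sp2_eq. Qed.
Fact Sp2_mul1 : left_id Sp2_one Sp2_mul.
Proof. by move=> g; apply: Sp2_eq. Qed.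
Fact Sp2_mulr1 : right_id Sp2_one Sp2_mul.
Proof. by move=> g; apply: Sp2_eq. Qed.
Fact Sp2_mulV : left_inverse Sp2_one Sp2_inverse Sp2_mul.
Proof. by move=> g; apply: Sp2_eq => x /=; rewrite Sp2_funK. Qed.
Fact Sp2_mulVr : right_inverse Sp2_one Sp2_inverse Sp2_mul.
Proof. by move=> g; apply: Sp2_eq => x /=; rewrite Sp2_invK. Qed.

HB.instance Definition _ :=
  isGroup.Build Sp2 Sp2_mulA Sp2_mul1 Sp2_mulr1 Sp2_mulV Sp2_mulVr.

Definition conjugate (g : Sp2) (L : AC2 -> AC2) : AC2 -> AC2 :=
  g \o L \o (g^-1)%g.

Definition form_of (L : AC2 -> AC2) (x y : AC2) : AC := omegaC (L x) y.

Definition bar_symmetric (b : AC2 -> AC2 -> AC) : Prop :=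
  forall x y, b x y = bar_sigmaC sigma (b y x).

Definition bar_inner_product (b : AC2 -> AC2 -> AC) : Prop :=
  bar_symmetric b /\
  forall x, regular_vector x ->
    nonneg_elements (bar_sigmaC sigma) (b x x) /\ (b x x = 0 <-> x = 0).

Definition quaternionic_structure (J : AC2 -> AC2) : Prop :=
  conj_linear J /\ forall x, J (J x) = - x.

Definition quaternionic_space : set (AC2 -> AC2) :=
  [set J | quaternionic_structure J /\ bar_inner_product (form_of J)].

End Symplectic.

Section Tangent.
Variables (R : realType) (A : falgType R).
Local Notation AC := (complexification A).
Local Notation V := ('cV[AC]_2 -> 'cV[AC]_2).

Definition smooth_near0 (eps : R) (f : R -> R) : Prop :=
  forall n t, `|t| < eps -> derivable (derive1n n f) t 1.

(* The real linear forms L |-> phi (cre (L x i 0)) and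
   L |-> phi (cim (L x i 0)) span the dual of the finite-dimensional real
   vector space of conj_linear maps, hence they detect smoothness and
   velocities of curves in that space. *)
Definition smooth_curve (eps : R) (gamma : R -> V) : Prop :=
  forall x i (phi : {scalar A}),
    smooth_near0 eps (fun t => phi (cre (gamma t x i 0))) /\
    smooth_near0 eps (fun t => phi (cim (gamma t x i 0))).

Definition velocity_at0 (gamma : R -> V) (L : V) : Prop :=
  forall x i (phi : {scalar A}),
    derive1 (fun t => phi (cre (gamma t x i 0))) 0 = phi (cre (L x i 0)) /\
    derive1 (fun t => phi (cim (gamma t x i 0))) 0 = phi (cim (L x i 0)).

(* gamma is a smooth curve in M, defined near 0, through the point J
   with velocity L. *)
Definition represents (M : set V) (J L : V) (gamma : R -> V) : Prop :=
  exists2 eps : R, 0 < eps &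
    [/\ smooth_curve eps gamma,
        (forall t, `|t| < eps -> M (gamma t)),
        gamma 0 = J
      & velocity_at0 gamma L].

Definition tangent_space (M : set V) (J : V) : set V :=
  [set L | exists gamma, represents M J L gamma].

Definition tangent_bundle (M : set V) : set (V * V) :=
  [set p | M p.1 /\ tangent_space M p.1 p.2].

End Tangent.

Definition acts_on (G : groupType) (X : Type) (act : G -> X -> X)
    (S : set X) : Prop :=
  [/\ (forall g p, S p -> S (act g p)),
      (forall p, S p -> act 1%g p = p)
    & (forall g h p, S p -> act (g * h)%g p = act g (act h p))].

Definition conjugate_pair (R : realType) (A : falgType R) (sigma : A -> A)
    (g : Sp2 sigma)
    (p : ('cV[complexification A]_2 -> 'cV[complexification A]_2) *
         ('cV[complexification A]_2 -> 'cV[complexification A]_2)) :=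
  (conjugate g p.1, conjugate g p.2).

(* Main.v *)
(* A curve in the space of quaternionic structures satisfies linear identities
   and J^2 = -1; differentiating them at 0 gives the three conditions on a
   velocity L. Conversely, given such an L at J, put X = - L J / 4. The
   conditions say that X is A_C-linear, skew for omega_C and anticommutes with
   J, so the Cayley transforms g_t = (1 + tX) (1 - tX)^-1 are symplectic for
   small t, and g_t J g_t^-1 = g_t^2 J has velocity 4 X J = L. Its entries are
   rational functions of t, which makes smoothness and differentiation
   elementary. *)
Require Import Defs.
From HB Require Import structures.
From mathcomp Require Import all_boot all_order all_algebra all_field.
From mathcomp Require Import all_classical all_reals all_analysis.
From mathcomp Require Import ring.

Set Implicit Arguments.
Unset Strict Implicit.
Unset Printing Implicit Defensive.

Import Order.TTheory GRing.Theory Num.Theory.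
Import numFieldNormedType.Exports passmx.

Local Open Scope classical_set_scope.
Local Open Scope ring_scope.

(** * Smooth and rational real functions on an interval around 0 *)

Section SmoothScalars.
Variable R : realType.
Implicit Types (eps : R) (f g : R -> R).

(** The ball of radius [eps - |t|] around [t] lies inside the ball of radius [eps] around 0. *)
Lemma near_ball0 eps t (P : R -> Prop) :
  `|t| < eps -> (forall s, `|s| < eps -> P s) -> \forall s \near t, P s.
Proof.
move=> te H; have d0 : 0 < eps - `|t| by rewrite subr_gt0.
apply/nbhs_ballP; exists (eps - `|t|) => // s; rewrite /ball /= ltrBrDr => ts.
apply: H; rewrite distrC in ts; apply: le_lt_trans ts.
by rewrite -{1}(subrK t s) ler_normD.
Qed.

Lemma smooth_near0_is_derive eps f : 0 < eps -> smooth_near0 eps f ->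
  is_derive (0 : R) (1 : R) f (derive1 f 0).
Proof.
move=> e0 /(_ 0 0); rewrite normr0 => /(_ e0) df.
by rewrite derive1E; apply/derivableP.
Qed.

Lemma smooth_near0D eps f g :
  smooth_near0 eps f -> smooth_near0 eps g ->
  smooth_near0 eps (fun t => f t + g t).
Proof.
move=> sf sg.
(* The formula for the n-th derivative holds on a whole open interval, so it can be differentiated
   once more. *)
suff E n t : `|t| < eps ->
    derive1n n (fun s => f s + g s) t = derive1n n f t + derive1n n g t.
  move=> n t te.
  apply: (@near_eq_derivable _ _ _ (derive1n n f + derive1n n g)).
    by apply: (near_ball0 te) => s se; rewrite /= E.
  by apply: derivableD; [apply: sf|apply: sg].
elim: n t => [//|n IH] t te; rewrite !derive1nS !derive1E.
rewrite -deriveD; [|exact: sf|exact: sg].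
by apply: near_eq_derive; apply: (near_ball0 te) => s se; rewrite IH.
Qed.

(** The denominator is nonzero on the whole interval, not just at 0, so the same [eps] survives
    sums, products and repeated differentiation. *)
Definition rational_near0 eps f : Prop :=
  exists p q : {poly R},
    forall t, `|t| < eps -> q.[t] != 0 /\ f t = p.[t] / q.[t].

Lemma eq_rational_near0 eps f g :
  (forall t, `|t| < eps -> f t = g t) -> rational_near0 eps g ->
  rational_near0 eps f.
Proof.
by move=> fg [p [q H]]; exists p, q => t te; have [? ?] := H t te; rewrite fg.
Qed.

Lemma rational_near0_poly eps (p : {poly R}) :
  rational_near0 eps (fun t => p.[t]).
Proof. by exists p, 1 => t _; rewrite hornerC oner_neq0 divr1. Qed.

Lemma rational_near0_cst eps (a : R) : rational_near0 eps (fun=> a).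
Proof.
apply: (eq_rational_near0 (g := fun t => (a%:P).[t])) => [t _|].
  by rewrite hornerC.
exact: rational_near0_poly.
Qed.

Lemma rational_near0_id eps : rational_near0 eps (fun t => t).
Proof.
apply: (eq_rational_near0 (g := fun t => ('X : {poly R}).[t])) => [t _|].
  by rewrite hornerX.
exact: rational_near0_poly.
Qed.

Lemma rational_near0D eps f g :
  rational_near0 eps f -> rational_near0 eps g ->
  rational_near0 eps (fun t => f t + g t).
Proof.
move=> [p [q H]] [p' [q' H']]; exists (p * q' + p' * q), (q * q') => t te.
have [q0 ->] := H t te; have [q0' ->] := H' t te.
by rewrite !hornerE mulf_neq0 // addf_div.
Qed.

Lemma rational_near0M eps f g :
  rational_near0 eps f -> rational_near0 eps g ->
  rational_near0 eps (fun t => f t * g t).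
Proof.
move=> [p [q H]] [p' [q' H']]; exists (p * p'), (q * q') => t te.
have [q0 ->] := H t te; have [q0' ->] := H' t te.
by rewrite mulf_div !hornerM mulf_neq0.
Qed.

Lemma rational_near0_sum eps (I : Type) (r : seq I) (F : I -> R -> R) :
  (forall i, rational_near0 eps (F i)) ->
  rational_near0 eps (fun t => \sum_(i <- r) F i t).
Proof.
move=> HF; elim: r => [|i r IH].
  apply: eq_rational_near0 (rational_near0_cst eps 0) => t _.
  by rewrite big_nil.
apply: eq_rational_near0 (rational_near0D (HF i) IH) => t _.
by rewrite big_cons.
Qed.

(** By the quotient rule the derivative has denominator [q ^+ 2], which vanishes nowhere that [q]
    does not. *)
Lemma rational_near0_is_derive eps f : rational_near0 eps f ->
  exists2 f', rational_near0 eps f' &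
    forall t, `|t| < eps -> is_derive (t : R) (1 : R) f (f' t).
Proof.
move=> [p [q H]].
exists (fun t => (p^`() * q - p * q^`()).[t] / (q ^+ 2).[t]) => [|t te].
  exists (p^`() * q - p * q^`()), (q ^+ 2) => t te; split=> //.
  by rewrite horner_exp expf_neq0 //; case: (H t te).
have [q0 _] := H t te.
apply: (@near_eq_is_derive _ _ _ (horner p * (fun s => (q.[s])^-1))).
  by apply: (near_ball0 te) => s se; rewrite /=; case: (H s se).
have dV : is_derive t 1 (fun s => (q.[s])^-1) (- (q.[t]) ^- 2 *: (q^`()).[t]).
  by apply: is_deriveV.
apply: is_derive_eq.
rewrite hornerD hornerN horner_exp !hornerM /GRing.scale /=; by field.
Qed.

(** Since derivatives stay rational on the same interval, induction on the order reaches all of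
    them. *)
Lemma rational_near0_smooth eps f : rational_near0 eps f -> smooth_near0 eps f.
Proof.
move=> rf.
suff H n : rational_near0 eps (derive1n n f).
  move=> n t te; have [f' _ d] := rational_near0_is_derive (H n).
  exact: (@ex_derive _ _ _ _ _ _ _ (d t te)).
elim: n => [//|n IH]; have [f' rf' d] := rational_near0_is_derive IH.
apply: eq_rational_near0 rf' => t te.
by rewrite derive1nS derive1E; have := d t te => -[].
Qed.

End SmoothScalars.

(** * Rational curves in a finite-dimensional real vector space, and resolvents of endomorphisms *)

Section RationalCurves.
Variables (R : realType) (V : vectType R).

Definition rational_curve (eps : R) (u : R -> V) : Prop :=
  forall psi : {scalar V}, rational_near0 eps (fun t => psi (u t)).

Local Notation e := (vbasis {:V}).
Let basis_e : basis_of fullv e := vbasisP fullv.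

Lemma coord_inj (u v : V) : (forall i, coord e i u = coord e i v) -> u = v.
Proof.
move=> H; rewrite (coord_vbasis (memvf u)) (coord_vbasis (memvf v)).
by apply: eq_bigr => i _; rewrite H.
Qed.

Lemma rational_curve_cst eps (v : V) : rational_curve eps (fun=> v).
Proof. by move=> psi; exact: rational_near0_cst. Qed.

Lemma rational_curveD eps (u w : R -> V) :
  rational_curve eps u -> rational_curve eps w ->
  rational_curve eps (fun t => u t + w t).
Proof.
move=> ru rw psi; apply: eq_rational_near0 (rational_near0D (ru psi) (rw psi)).
by move=> t _; rewrite linearD.
Qed.

Lemma rational_curveZ eps (f : R -> R) (u : R -> V) :
  rational_near0 eps f -> rational_curve eps u ->
  rational_curve eps (fun t => f t *: u t).
Proof.
move=> rf ru psi; apply: eq_rational_near0 (rational_near0M rf (ru psi)).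
by move=> t _; rewrite linearZ.
Qed.

Lemma rational_curve_linear eps (F : {linear V -> V}) (u : R -> V) :
  rational_curve eps u -> rational_curve eps (fun t => F (u t)).
Proof. by move=> ru psi; have := ru (psi \o F). Qed.

(* Cramer's rule: the entries of (1 - tX)^-1 are quotients of polynomials in t
   whose common denominator det (1 - tX) is 1 at t = 0. *)
Lemma resolvent (X : {linear V -> V}) :
  exists2 eps : R, 0 < eps & exists S : R -> V -> V,
    [/\ (forall t v, `|t| < eps -> S t (v - t *: X v) = v),
        (forall t v, `|t| < eps -> S t v - t *: X (S t v) = v)
      & (forall u, rational_curve eps u ->
           rational_curve eps (fun t => S t (u t)))].
Proof.
(* [M] is the matrix of [X] on coordinate rows, so it multiplies from the right; [P] has polynomial
   entries and specialises at [t] to [1 - tM]. *)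
pose M := lin1_mx (rVof e \o X \o vecof e).
pose P := 1%:M - 'X *: map_mx polyC M.
pose ev (t : R) : 'M[{poly R}]_(\dim {:V}) -> 'M[R]_(\dim {:V}) :=
  map_mx (horner_eval t).
have evP t : ev t P = 1%:M - t *: M.
  apply/matrixP => i j; rewrite !mxE /horner_eval !hornerE.
  by case: (i == j); rewrite !hornerE.
have detP t : (\det P).[t] = \det (1%:M - t *: M).
  by rewrite -evP det_map_mx.
(* The determinant of [P] is continuous with value 1 at 0, hence nonzero near 0; this fixes
   [eps]. *)
have [eps e0 He] : exists2 eps : R, 0 < eps &
    forall t, `|t| < eps -> (\det P).[t] != 0.
  have : \forall t \near (0 : R), (\det P).[t] != 0.
    have c : {for (0 : R), continuous (fun t => (\det P).[t])}.
      apply: differentiable_continuous; apply/derivable1_diffP.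
      exact: derivable_horner.
    apply: cvgr_neq0 c _.
    by rewrite detP scale0r subr0 det1 oner_neq0.
  case/nbhs_ballP => eps /= e0 H; exists eps => // t te; apply: H.
  by rewrite /ball /= sub0r normrN.
exists eps => //.
pose B t := ((\det P).[t])^-1 *: ev t (\adj P).
have BM t : `|t| < eps -> B t *m (1%:M - t *: M) = 1%:M.
  move=> te; rewrite /B -scalemxAl -evP -map_mxM mul_adj_mx map_scalar_mx.
  by rewrite -scalemx1 scalerA mulVf ?scale1r // He.
have MB t : `|t| < eps -> (1%:M - t *: M) *m B t = 1%:M.
  move=> te; rewrite /B -scalemxAr -evP -map_mxM mul_mx_adj map_scalar_mx.
  by rewrite -scalemx1 scalerA mulVf ?scale1r // He.
have XM t v : rVof e (v - t *: X v) = rVof e v *m (1%:M - t *: M).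
  rewrite mulmxBr mulmx1 -scalemxAr mul_rV_lin1 /= rVofK //.
  by rewrite linearB linearZ.
exists (fun t v => vecof e (rVof e v *m B t)); split=> [t v te|t v te|u ru psi].
- by rewrite XM -mulmxA MB // mulmx1 rVofK.
- apply: (can_inj (rVofK basis_e)).
  by rewrite XM vecofK // -mulmxA BM // mulmx1.
(* [F] is the value of [psi] on the curve expanded in coordinates; each [B t i j] is an adjugate
   entry divided by the determinant. *)
pose F t := \sum_j (\sum_i coord e i (u t) * B t i j) * psi (e`_j).
apply: (eq_rational_near0 (g := F)) => [t te|].
  rewrite /vecof linear_sum; apply: eq_bigr => j _.
  rewrite linearZ /= mxE; congr (_ * _).
  by apply: eq_bigr => i _; rewrite mxE.
apply: rational_near0_sum => j.
apply: rational_near0M; last exact: rational_near0_cst.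
apply: rational_near0_sum => i; apply: rational_near0M; first exact: ru.
exists ((\adj P) i j), (\det P) => t te; split; first exact: He.
by rewrite !mxE mulrC.
Qed.

End RationalCurves.

(* The additive group of A_C^2 with scalars restricted to R. *)
Definition realV (R : realType) (A : falgType R) : Type :=
  'cV[complexification A]_2.

Lemma ord2E (i : 'I_2) : i = 0 \/ i = 1.
Proof. by case: i => [[|[|]]] // ?; [left|right]; apply: val_inj. Qed.

(** * The real vector space underlying the columns *)

Section RealStructure.
Variables (R : realType) (A : falgType R).
Local Notation AC := (complexification A).
Local Notation V := (realV A).

(** Only the additive structure is inherited from matrices, so that the scalars of [V] can be real
    instead of those of the matrix entries. *)
HB.instance Definition _ := GRing.Zmodule.on V.

Definition real_scale (r : R) (x : V) : V :=
  \col_i Cplx (r *: cre (x i 0)) (r *: cim (x i 0)).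

Lemma colP2 (x y : 'cV[AC]_2) : (forall i, x i 0 = y i 0) -> x = y.
Proof. by move=> H; apply/matrixP => i j; rewrite ord1. Qed.

Fact real_scaleA r s x : real_scale r (real_scale s x) = real_scale (r * s) x.
Proof. by apply: colP2 => i; rewrite !mxE /= !scalerA. Qed.
Fact real_scale1 : left_id 1 real_scale.
Proof.
by move=> x; apply: colP2 => i; rewrite !mxE !scale1r; case: (x i 0).
Qed.
Fact real_scaleDr : right_distributive real_scale +%R.
Proof.
by move=> r x y; apply: colP2 => i; rewrite !mxE; apply: cplx_eq;
   rewrite /= scalerDr.
Qed.
Fact real_scaleDl x : {morph real_scale^~ x : r s / r + s}.
Proof.
by move=> r s; apply: colP2 => i; rewrite !mxE; apply: cplx_eq;
   rewrite /= scalerDl.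
Qed.
HB.instance Definition _ := GRing.Zmodule_isLmodule.Build R V
  real_scaleA real_scale1 real_scaleDr real_scaleDl.

Definition real_code (x : V) : A * A * (A * A) :=
  ((cre (x 0 0), cim (x 0 0)), (cre (x 1 0), cim (x 1 0))).

(** Coordinates are transported from four copies of [A] along the bijection [real_code]. *)
Fact real_vect_axiom : Vector.axiom (\dim {: (A * A * (A * A))%type}) V.
Proof.
pose e := vbasis {: (A * A * (A * A))%type}.
have be : basis_of fullv e := vbasisP fullv.
exists (fun x => rVof e (real_code x)).
  move=> r x y; rewrite -linearP; congr rVof.
  by rewrite /real_code !mxE.
exists (fun v => let p := vecof e v : A * A * (A * A) in
  \col_i if i == 0 then Cplx p.1.1 p.1.2 else Cplx p.2.1 p.2.2).
  move=> x; rewrite rVofK //; apply: colP2 => i; rewrite mxE.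
  by have [->|->] := ord2E i; apply: cplx_eq.
move=> v; rewrite -[RHS](vecofK be); congr rVof; rewrite /real_code !mxE /=.
by case: (vecof e v) => [[? ?] [? ?]].
Qed.
HB.instance Definition _ := Lmodule_hasFinDim.Build R V real_vect_axiom.

End RealStructure.

(** * Real-linear maps on columns, and curves tested by real functionals *)

Section ComplexColumns.
Variables (R : realType) (A : falgType R).
Local Notation AC := (complexification A).
Local Notation V := (realV A).
Local Notation AC2 := ('cV[AC]_2).

(** Real scalars are central and fixed by conjugation. Real scaling is thus a right multiplication,
    and right-linear and conjugate-linear maps are both real-linear. *)
Definition realC (r : R) : AC := Cplx r%:A 0.

Lemma mulr_realC (a : AC) r : a * realC r = Cplx (r *: cre a) (r *: cim a).
Proof.
by apply: cplx_eq; rewrite /= mulr0 -scalerAr mulr1 ?subr0 ?add0r.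
Qed.

Lemma mul_realCr (a : AC) r : realC r * a = Cplx (r *: cre a) (r *: cim a).
Proof.
by apply: cplx_eq; rewrite /= mul0r -scalerAl mul1r ?subr0 ?addr0.
Qed.

Lemma cconj_realC r : cconj (realC r) = realC r.
Proof. by rewrite /cconj /= oppr0. Qed.

Lemma scale_realV (r : R) (x : V) : r *: x = rscale x (realC r).
Proof. by apply: colP2 => i; rewrite !mxE mulr_realC. Qed.

Lemma cconjK : involutive (@cconj R A).
Proof. by move=> a; apply: cplx_eq; rewrite /= ?opprK. Qed.

Lemma rscaleDl (x y : AC2) a : rscale (x + y) a = rscale x a + rscale y a.
Proof. by apply: colP2 => i; rewrite !mxE mulrDl. Qed.

Lemma rscaleA (x : AC2) a b : rscale (rscale x a) b = rscale x (a * b).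
Proof. by apply: colP2 => i; rewrite !mxE mulrA. Qed.

Lemma rscale_linear a : linear (fun x : V => rscale x a : V).
Proof.
move=> r x y; rewrite !scale_realV rscaleDl !rscaleA.
by rewrite mulr_realC mul_realCr.
Qed.

Lemma right_linear_linear (f : AC2 -> AC2) : right_linear f ->
  linear (f : V -> V).
Proof. by move=> [fD fZ] r x y; rewrite !scale_realV fD fZ. Qed.

Lemma conj_linear_linear (f : AC2 -> AC2) : conj_linear f ->
  linear (f : V -> V).
Proof. by move=> [fD fZ] r x y; rewrite !scale_realV fD fZ cconj_realC. Qed.

Definition linear_map (f : V -> V) (fL : linear f) : {linear V -> V} :=
  HB.pack f (GRing.isLinear.Build R V V _ f fL).

Lemma linear_funN (f : V -> V) : linear f -> {morph f : x / - x}.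
Proof. by move=> fL x; exact: (linearN (linear_map fL)). Qed.

Lemma linear_fun0 (f : V -> V) : linear f -> f 0 = 0.
Proof. by move=> fL; exact: (linear0 (linear_map fL)). Qed.

Lemma linear_funD (f : V -> V) : linear f -> {morph f : x y / x + y}.
Proof. by move=> fL x y; exact: (linearD (linear_map fL)). Qed.

Lemma linear_funZ (f : V -> V) r x : linear f -> f (r *: x) = r *: f x.
Proof. by move=> fL; exact: (linearZZ (linear_map fL)). Qed.

(** The maps [col_re] and [col_im] embed [A] as the four real summands of [V]; composing with them
    pulls functionals on [V] back to [A]. *)
Definition col_re (i : 'I_2) (a : A) : V :=
  \col_j if j == i then Cplx a 0 else 0.
Definition col_im (i : 'I_2) (a : A) : V :=
  \col_j if j == i then Cplx 0 a else 0.

Fact col_re_linear i : linear (col_re i).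
Proof.
move=> r a b; apply: colP2 => j; rewrite !mxE; case: ifP => _;
  by apply: cplx_eq; rewrite /= ?scaler0 ?addr0.
Qed.
HB.instance Definition _ i :=
  GRing.isLinear.Build R A V _ (col_re i) (col_re_linear i).

Fact col_im_linear i : linear (col_im i).
Proof.
move=> r a b; apply: colP2 => j; rewrite !mxE; case: ifP => _;
  by apply: cplx_eq; rewrite /= ?scaler0 ?addr0.
Qed.
HB.instance Definition _ i :=
  GRing.isLinear.Build R A V _ (col_im i) (col_im_linear i).

Lemma realVE (x : V) :
  x = (col_re 0 (cre (x 0 0)) + col_im 0 (cim (x 0 0)))
    + (col_re 1 (cre (x 1 0)) + col_im 1 (cim (x 1 0))).
Proof.
apply: colP2 => i; rewrite !mxE.
by have [->|->] := ord2E i; apply: cplx_eq;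
  rewrite /= ?addr0 ?add0r.
Qed.

Definition entry_re (i : 'I_2) (x : V) : A := cre (x i 0).
Definition entry_im (i : 'I_2) (x : V) : A := cim (x i 0).
Fact entry_re_linear i : linear (entry_re i).
Proof. by move=> r x y; rewrite /entry_re !mxE. Qed.
HB.instance Definition _ i :=
  GRing.isLinear.Build R V A _ (entry_re i) (entry_re_linear i).
Fact entry_im_linear i : linear (entry_im i).
Proof. by move=> r x y; rewrite /entry_im !mxE. Qed.
HB.instance Definition _ i :=
  GRing.isLinear.Build R V A _ (entry_im i) (entry_im_linear i).

(** A functional on [V] is a sum of four functionals of the entries by [realVE]; conversely, a
    functional of an entry is one on [V]. *)
Lemma smooth_curve_scalar eps (gamma : R -> V -> V) :
  @smooth_curve R A eps gamma <->
  forall x (psi : {scalar V}), smooth_near0 eps (fun t => psi (gamma t x)).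
Proof.
split=> [H x psi|H x i phi]; last first.
  by split; [exact: (H x (phi \o entry_re i))|exact: (H x (phi \o entry_im i))].
have E : (fun t => psi (gamma t x)) = fun t =>
   (psi (col_re 0 (cre (gamma t x 0 0)))
      + psi (col_im 0 (cim (gamma t x 0 0))))
 + (psi (col_re 1 (cre (gamma t x 1 0)))
      + psi (col_im 1 (cim (gamma t x 1 0)))).
  by apply/funext => t; rewrite -!linearD -realVE.
rewrite E; apply: smooth_near0D; apply: smooth_near0D.
- exact: (H x 0 (psi \o col_re 0)).1.
- exact: (H x 0 (psi \o col_im 0)).2.
- exact: (H x 1 (psi \o col_re 1)).1.
- exact: (H x 1 (psi \o col_im 1)).2.
Qed.

(** [velocity_at0] prescribes only values of [derive1]; smoothness supplies the derivability
    contained in [is_derive]. *)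
Lemma velocity_at0_scalar eps (gamma : R -> V -> V) (L : V -> V) : 0 < eps ->
  @smooth_curve R A eps gamma ->
  @velocity_at0 R A gamma L <->
  forall x (psi : {scalar V}),
    is_derive (0 : R) (1 : R) (fun t => psi (gamma t x)) (psi (L x)).
Proof.
move=> e0 sg; split=> [H x psi|H x i phi]; last first.
  split; rewrite derive1E.
    by exact: (@derive_val _ _ _ _ _ _ _ (H x (phi \o entry_re i))).
  by exact: (@derive_val _ _ _ _ _ _ _ (H x (phi \o entry_im i))).
have E : (fun t => psi (gamma t x)) =
   ((fun t => psi (col_re 0 (cre (gamma t x 0 0)))) +
    (fun t => psi (col_im 0 (cim (gamma t x 0 0)))))
 + ((fun t => psi (col_re 1 (cre (gamma t x 1 0)))) +
    (fun t => psi (col_im 1 (cim (gamma t x 1 0))))).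
  by apply/funext => t; rewrite [LHS](congr1 psi (realVE _)) !linearD.
have d i : is_derive (0 : R) (1 : R)
    (fun t => psi (col_re i (cre (gamma t x i 0))))
    (psi (col_re i (cre (L x i 0)))).
  apply: is_derive_eq (H x i (psi \o col_re i)).1.
  by apply: (smooth_near0_is_derive e0); exact: (sg x i (psi \o col_re i)).1.
have d' i : is_derive (0 : R) (1 : R)
    (fun t => psi (col_im i (cim (gamma t x i 0))))
    (psi (col_im i (cim (L x i 0)))).
  apply: is_derive_eq (H x i (psi \o col_im i)).2.
  by apply: (smooth_near0_is_derive e0); exact: (sg x i (psi \o col_im i)).2.
rewrite E (congr1 psi (realVE (L x))) !linearD.
exact: is_deriveD.
Qed.

Lemma representsE (M : set (AC2 -> AC2)) J L gamma :
  represents M J L gamma <->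
  exists2 eps : R, 0 < eps &
    [/\ forall x (psi : {scalar V}),
          smooth_near0 eps (fun t => psi (gamma t x)),
        forall t, `|t| < eps -> M (gamma t),
        gamma 0 = J
      & forall x (psi : {scalar V}),
          is_derive (0 : R) (1 : R) (fun t => psi (gamma t x)) (psi (L x))].
Proof.
split=> -[eps e0 [sg Mg g0 vL]]; exists eps => //.
  split=> //; first exact/smooth_curve_scalar.
  exact/(velocity_at0_scalar L e0 sg).
have sg' : smooth_curve eps gamma by apply/smooth_curve_scalar.
by split=> //; apply/(velocity_at0_scalar L e0 sg').
Qed.

End ComplexColumns.

(** * Algebraic rules for the symplectic form *)

Section SymplecticForm.
Variables (R : realType) (A : falgType R) (sigma : A -> A).
Local Notation AC := (complexification A).
Local Notation V := (realV A).
Local Notation AC2 := ('cV[AC]_2).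
Hypothesis sigma_anti : anti_involution sigma.
Local Notation omega := (omegaC sigma).

Let sigma_linear : linear sigma. Proof. by case: sigma_anti. Qed.
Let sigmaD a b : sigma (a + b) = sigma a + sigma b.
Proof. by have := sigma_linear 1 a b; rewrite !scale1r. Qed.
Let sigma0 : sigma 0 = 0.
Proof. by apply: (addIr (sigma 0)); rewrite -sigmaD !add0r. Qed.
Let sigmaZ r a : sigma (r *: a) = r *: sigma a.
Proof. by have := sigma_linear r a 0; rewrite !addr0 sigma0 addr0. Qed.
Let sigmaN a : sigma (- a) = - sigma a.
Proof. by rewrite -scaleN1r sigmaZ scaleN1r. Qed.
Let sigmaM a b : sigma (a * b) = sigma b * sigma a.
Proof. by case: sigma_anti. Qed.
Let sigmaK : involutive sigma. Proof. by case: sigma_anti. Qed.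

Lemma sigmaCD a b : sigmaC sigma (a + b) = sigmaC sigma a + sigmaC sigma b.
Proof. by apply: cplx_eq; rewrite /= sigmaD. Qed.
Lemma sigmaCN a : sigmaC sigma (- a) = - sigmaC sigma a.
Proof. by apply: cplx_eq; rewrite /= sigmaN. Qed.
Lemma sigmaCM a b : sigmaC sigma (a * b) = sigmaC sigma b * sigmaC sigma a.
Proof.
by apply: cplx_eq; rewrite /= !(sigmaD, sigmaN, sigmaM) // addrC.
Qed.
Lemma sigmaCK : involutive (sigmaC sigma).
Proof. by move=> a; apply: cplx_eq; rewrite /= sigmaK. Qed.
Lemma bar_sigmaCE a : bar_sigmaC sigma a = cconj (sigmaC sigma a).
Proof. by []. Qed.
Lemma bar_sigmaC_sigmaC a : bar_sigmaC sigma (sigmaC sigma a) = cconj a.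
Proof. by rewrite bar_sigmaCE sigmaCK. Qed.
Lemma sigmaC_bar_sigmaC a : sigmaC sigma (bar_sigmaC sigma a) = cconj a.
Proof. by apply: cplx_eq; rewrite /= ?sigmaN sigmaK. Qed.

Lemma omegaCE x y :
  omega x y = sigmaC sigma (x 0 0) * y 1 0 - sigmaC sigma (x 1 0) * y 0 0.
Proof.
rewrite /omegaC !mxE !big_ord_recl !big_ord0 !mxE.
rewrite !big_ord_recl !big_ord0 !mxE /=.
rewrite !(mulr0, mulr1, addr0, add0r, mulrN) mulNr addrC.
by congr (_ * y _ 0 - _ * y _ 0); do ?congr (sigmaC _ (x _ _)); apply: val_inj.
Qed.

(** This skew-symmetry derives each rule for the left argument from the one for the right. *)
Lemma omegaC_sym x y : omega x y = - sigmaC sigma (omega y x).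
Proof. by rewrite !omegaCE sigmaCD sigmaCN !sigmaCM !sigmaCK opprB. Qed.

Lemma omegaCDr x y z : omega x (y + z) = omega x y + omega x z.
Proof. by rewrite !omegaCE !mxE !mulrDr opprD addrACA. Qed.

Lemma omegaCDl x y z : omega (x + y) z = omega x z + omega y z.
Proof. by rewrite !(omegaC_sym _ z) omegaCDr sigmaCD opprD. Qed.

Lemma omegaCZr x y a : omega x (rscale y a) = omega x y * a.
Proof. by rewrite !omegaCE !mxE mulrBl !mulrA. Qed.

Lemma omegaCZl x y a : omega (rscale x a) y = sigmaC sigma a * omega x y.
Proof. by rewrite omegaC_sym omegaCZr sigmaCM -mulrN -omegaC_sym. Qed.

Lemma omegaCNr x y : omega x (- y) = - omega x y.
Proof. by rewrite !omegaCE !mxE !mulrN opprD. Qed.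

Lemma omegaCNl x y : omega (- x) y = - omega x y.
Proof. by rewrite omegaC_sym omegaCNr sigmaCN -omegaC_sym. Qed.

Lemma sigmaC_realC r : sigmaC sigma (realC A r) = realC A r.
Proof.
have s1 : sigma 1 = 1.
  by rewrite -[LHS]mulr1 -{2}(sigmaK 1) -sigmaM mulr1 sigmaK.
by apply: cplx_eq; rewrite /= ?sigma0 // sigmaZ s1.
Qed.

Lemma omegaC_scaler (r : R) (x y : V) :
  omega x (r *: y) = omega x y * realC A r.
Proof. by rewrite scale_realV omegaCZr. Qed.

Lemma omegaC_scalel (r : R) (x y : V) :
  omega (r *: x) y = omega x y * realC A r.
Proof. by rewrite scale_realV omegaCZl sigmaC_realC mulr_realC mul_realCr. Qed.

(** The value of the form is repeated in both entries of a column to obtain an endomorphism of [V],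
    the kind of map that the velocity lemmas accept. *)
Lemma linear_omegaC (y : V) : linear (fun x : V => const_mx (omega x y) : V).
Proof.
move=> r x x'; apply: colP2 => i; rewrite !mxE omegaCDl omegaC_scalel.
by rewrite mulr_realC.
Qed.

Lemma bar_sigmaC_linear : linear (fun x : V => map_mx (bar_sigmaC sigma) x : V).
Proof.
move=> r x y; apply: colP2 => i; rewrite !mxE; apply: cplx_eq.
  by rewrite /= sigma_linear.
by rewrite /= sigma_linear opprD scalerN.
Qed.

End SymplecticForm.

(** * Conjugation by the symplectic group *)

Section Conjugation.
Variables (R : realType) (A : falgType R) (sigma : A -> A).
Local Notation AC := (complexification A).
Local Notation V := (realV A).
Local Notation AC2 := ('cV[AC]_2).
Local Notation M := (quaternionic_space sigma).
Implicit Types (g h : Sp2 sigma) (J L : AC2 -> AC2).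

Lemma Sp2VK g x : g ((g^-1)%g x) = x. Proof. exact: Sp2_invK. Qed.
Lemma Sp2KV g x : (g^-1)%g (g x) = x. Proof. exact: Sp2_funK. Qed.

Lemma conjugate1 L : conjugate (1%g : Sp2 sigma) L = L.
Proof. by []. Qed.

Lemma conjugateM g h L : conjugate (g * h)%g L = conjugate g (conjugate h L).
Proof. by []. Qed.

Lemma conjugateK g L : conjugate (g^-1)%g (conjugate g L) = L.
Proof. by apply/funext => x; rewrite /conjugate /= !Sp2_funK. Qed.

Lemma conjugateVK g L : conjugate g (conjugate (g^-1)%g L) = L.
Proof. by apply/funext => x; rewrite /conjugate /= !Sp2_invK. Qed.

Lemma conj_linear_conjugate g J : conj_linear J -> conj_linear (conjugate g J).
Proof.
move=> [JD JZ]; have [gD gZ] := Sp2_right_linear g.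
have /= [hD hZ] := Sp2_right_linear (g^-1)%g.
by split=> [x y|x a]; rewrite /conjugate /= ?hD ?JD ?gD // hZ JZ gZ.
Qed.

(** Since [g] preserves the symplectic form, the form of the conjugate is the pullback along the
    inverse of [g]. *)
Lemma form_of_conjugate g J x y :
  form_of sigma (conjugate g J) x y =
  form_of sigma J ((g^-1)%g x) ((g^-1)%g y).
Proof.
by rewrite /form_of /conjugate /= -{1}(Sp2VK g y) Sp2_omega.
Qed.

Lemma bar_symmetric_conjugate g J : bar_symmetric sigma (form_of sigma J) ->
  bar_symmetric sigma (form_of sigma (conjugate g J)).
Proof. by move=> bJ x y; rewrite !form_of_conjugate. Qed.

(** If [y] completes [x] to a basis, then [g y] completes [g x]. *)
Lemma regular_vector_Sp2 g x : regular_vector x -> regular_vector (g x).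
Proof.
have [gD gZ] := Sp2_right_linear g.
move=> [y [fR fb]]; exists (g y).
(* In [regular_vector] the bound [f] takes a plain function of two indices, and columns are coerced
   to such functions; these types make the later [change] a conversion. *)
pose f (c : 'I_2 -> 'I_1 -> AC) : AC2 := rscale x (c 0 0) + rscale y (c 1 0).
pose f' (c : 'I_2 -> 'I_1 -> AC) : AC2 :=
  rscale (g x) (c 0 0) + rscale (g y) (c 1 0).
have E c : f' c = g (f c) by rewrite /f /f' gD !gZ.
have [fD fZ] : right_linear (fun c : AC2 => f c) by [].
change (right_linear (fun c : AC2 => f' c) /\ bijective f').
split; first split=> [c d|c a].
- by rewrite !E fD gD.
- by rewrite !E fZ gZ.
apply: eq_bij (fun c => esym (E c)).
apply: bij_comp (fb : bijective f).
by exists (g^-1)%g; [exact: Sp2KV|exact: Sp2VK].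
Qed.

Lemma Sp2_linear g : linear (g : V -> V).
Proof. exact: right_linear_linear (Sp2_right_linear g). Qed.

Lemma quaternionic_space_conjugate g J : M J -> M (conjugate g J).
Proof.
move=> [[Jc J2] [Js Jp]]; split; split.
- exact: conj_linear_conjugate.
- move=> x; rewrite /conjugate /= Sp2_funK J2.
  by rewrite (linear_funN (Sp2_linear g)) Sp2_invK.
- exact: bar_symmetric_conjugate.
(* Regularity and vanishing are moved back along the inverse of [g], where the form of [J] is
   definite. *)
move=> x /(regular_vector_Sp2 (g^-1)%g) /Jp; rewrite form_of_conjugate.
move=> [Jx0 Jx]; split=> //; rewrite Jx; split=> [|->].
  by move/(congr1 g); rewrite Sp2VK (linear_fun0 (Sp2_linear g)).
exact: (linear_fun0 (Sp2_linear (g^-1)%g)).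
Qed.

(** A functional composed with [g] is again a functional, so the conjugated curve at [x] is
    controlled by the original one at the preimage of [x]. *)
Lemma represents_conjugate g J L gamma : represents M J L gamma ->
  represents M (conjugate g J) (conjugate g L)
    (fun t => conjugate g (gamma t)).
Proof.
move=> /representsE[eps e0 [sg Mg g0 vL]]; apply/representsE; exists eps => //.
pose G := linear_map (Sp2_linear g).
split=> [x psi|t te||x psi].
- exact: (sg ((g^-1)%g x) (psi \o G)).
- exact/quaternionic_space_conjugate/Mg.
- by rewrite g0.
- exact: (vL ((g^-1)%g x) (psi \o G)).
Qed.

Lemma tangent_space_conjugate_sub g J L : tangent_space M J L ->
  tangent_space M (conjugate g J) (conjugate g L).
Proof.
move=> [gamma rep]; exists (fun t => conjugate g (gamma t)).
exact: represents_conjugate.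
Qed.

Lemma tangent_space_conjugate g J :
  tangent_space M (conjugate g J) =
  [set conjugate g L | L in tangent_space M J].
Proof.
rewrite eqEsubset; split=> [L TL|_ [L TL <-]].
  (* This inclusion is the other one applied to the inverse of [g]. *)
  exists (conjugate (g^-1)%g L); last exact: conjugateVK.
  by rewrite -(conjugateK g J); exact: tangent_space_conjugate_sub.
exact: tangent_space_conjugate_sub.
Qed.

End Conjugation.

(** * Velocities at 0 and their calculus *)

Section Velocities.
Variables (R : realType) (V : vectType R).
Implicit Types (u w : R -> V) (v : V).

Definition has_velocity u v : Prop :=
  forall psi : {scalar V},
    is_derive (0 : R) (1 : R) (fun t => psi (u t)) (psi v).

(** Coordinate functionals separate vectors. This turns an identity valid along a curve near 0 into
    an identity between velocities. *)
Lemma has_velocity_unique (eps : R) u w v v' : 0 < eps ->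
  (forall t, `|t| < eps -> u t = w t) ->
  has_velocity u v -> has_velocity w v' -> v = v'.
Proof.
move=> e0 uw du dw; apply: coord_inj => i.
rewrite -(@derive_val _ _ _ _ _ _ _ (du (coord (vbasis {:V}) i))).
rewrite -(@derive_val _ _ _ _ _ _ _ (dw (coord (vbasis {:V}) i))).
apply: near_eq_derive; apply: near_ball0; first by rewrite normr0; exact: e0.
by move=> s se; rewrite uw.
Qed.

Lemma has_velocity_cst v : has_velocity (fun=> v) 0.
Proof. by move=> psi; rewrite linear0; exact: is_derive_cst. Qed.

Lemma has_velocityD u w v v' : has_velocity u v -> has_velocity w v' ->
  has_velocity (fun t => u t + w t) (v + v').
Proof.
move=> du dw psi; rewrite linearD.
have -> : (fun t => psi (u t + w t)) =
    (fun t => psi (u t)) + (fun t => psi (w t)).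
  by apply/funext => t; rewrite linearD.
by apply: is_deriveD; [exact: du|exact: dw].
Qed.

Lemma has_velocity_linear (F : {linear V -> V}) u v : has_velocity u v ->
  has_velocity (fun t => F (u t)) (F v).
Proof. by move=> du psi; exact: (du (psi \o F)). Qed.

(** In the product rule the term with the derivative of [u] carries the factor [t], which is 0
    here. *)
Lemma rational_has_velocity eps u v : 0 < eps -> rational_curve eps u ->
  has_velocity (fun t => v + t *: u t) (u 0).
Proof.
move=> e0 ru psi.
have [f' _ /(_ 0)] := rational_near0_is_derive (ru psi).
rewrite normr0 => /(_ e0) du.
have -> : (fun t => psi (v + t *: u t)) =
          cst (psi v) + (id : R -> R) * (fun t => psi (u t)).
  by apply/funext => t; rewrite linearD linearZ.
apply: is_derive_eq.
by rewrite scale0r add0r add0r /GRing.scale /= mulr1.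
Qed.

(* The product rule: in a fixed basis, gamma t (u t) is bilinear in the
   coordinates of gamma t and of u t. *)
Lemma has_velocity_app eps (gamma : R -> V -> V) (L : {linear V -> V}) u v :
  0 < eps -> (forall t, `|t| < eps -> linear (gamma t)) ->
  (forall x, has_velocity (gamma^~ x) (L x)) -> has_velocity u v ->
  has_velocity (fun t => gamma t (u t)) (gamma 0 v + L (u 0)).
Proof.
move=> e0 gL dg du psi; pose e := vbasis {:V}.
have gE t x : `|t| < eps ->
    psi (gamma t x) = \sum_i coord e i x * psi (gamma t e`_i).
  move=> te; pose G : {linear V -> V} :=
    HB.pack (gamma t) (GRing.isLinear.Build R V V _ (gamma t) (gL t te)).
  rewrite -[gamma t]/(G : V -> V) {1}(coord_vbasis (memvf x)) !linear_sum.
  by apply: eq_bigr => i _; rewrite !linearZ.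
have e0' : `|0 : R| < eps by rewrite normr0.
apply: (@near_eq_is_derive _ _ _
  (\sum_i (fun t => coord e i (u t)) * (fun t => psi (gamma t e`_i)))).
  by apply: near_ball0 e0' _ => t te; rewrite gE // fct_sumE.
rewrite linearD gE //.
rewrite {1}(coord_vbasis (memvf (u 0))) !linear_sum -big_split.
have d i : is_derive (0 : R) (1 : R)
   ((fun t => coord e i (u t)) * (fun t => psi (gamma t e`_i)))
   (coord e i v * psi (gamma 0 e`_i) + psi (L (coord e i (u 0) *: e`_i))).
  apply: is_derive_eq (is_deriveM (du (coord e i)) (dg e`_i psi)) _.
  by rewrite !linearZ /= addrC mulrC.
exact: is_derive_sum.
Qed.

End Velocities.

(** * The tangent space: both inclusions *)

Section TangentSpace.
Variables (R : realType) (A : falgType R) (sigma : A -> A).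
Hypothesis sigma_anti : anti_involution sigma.
Local Notation AC := (complexification A).
Local Notation V := (realV A).
Local Notation AC2 := ('cV[AC]_2).
Local Notation M := (quaternionic_space sigma).
Local Notation omega := (omegaC sigma).
Implicit Types (J L : AC2 -> AC2).

Lemma tangent_space_sub J L : M J -> tangent_space M J L ->
  [/\ conj_linear L, bar_symmetric sigma (form_of sigma L)
    & forall x, L (J x) + J (L x) = 0].
Proof.
move=> MJ [gamma /representsE[eps e0 [_ Mg g0 vL]]].
have gc t : `|t| < eps -> conj_linear (gamma t) by move=> /Mg [[]].
have dL (x : V) : has_velocity (fun t => gamma t x : V) (L x) by exact: vL.
have Lc : conj_linear L.
  split=> [x y|x a].
    apply: (has_velocity_unique e0 _ (dL (x + y))
              (has_velocityD (dL x) (dL y))).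
    by move=> t /gc [gD _]; rewrite gD.
  pose F := linear_map (rscale_linear (cconj a)).
  apply: (has_velocity_unique e0 _ (dL (rscale x a))
            (has_velocity_linear F (dL x))).
  by move=> t /gc [_ gZ]; rewrite gZ.
split=> // [x y|x].
  pose F y := linear_map (linear_omegaC sigma_anti y).
  pose B := linear_map (bar_sigmaC_linear sigma_anti).
  have E := has_velocity_unique e0 _ (has_velocity_linear (F y) (dL x))
    (has_velocity_linear B (has_velocity_linear (F x) (dL y))).
  have /matrixP/(_ 0 0) : F y (L x) = B (F x (L y)).
    apply: E => t /Mg [_ [bs _]]; apply: colP2 => i; rewrite !mxE.
    exact: bs.
  by rewrite !mxE.
pose LL := linear_map (conj_linear_linear Lc).
have gl t : `|t| < eps -> linear (gamma t : V -> V).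
  by move=> /gc; exact: conj_linear_linear.
(* The identity [gamma t (gamma t x) = - x] has a constant right side, so the velocity of its left
   side, [gamma 0 (L x) + L (gamma 0 x)], vanishes. *)
have d := has_velocity_app (L := LL) e0 gl dL (dL x).
have E := has_velocity_unique e0 _ d (has_velocity_cst (- x : V)).
rewrite addrC -g0; apply: E => t /Mg [[_ sq] _]; exact: sq.
Qed.

Lemma scale_rscale (r : R) (v : V) a :
  r *: (rscale v a : V) = rscale (r *: v) a.
Proof.
by rewrite !scale_realV !rscaleA; congr rscale; rewrite mulr_realC mul_realCr.
Qed.

(** * Cayley transforms of skew right-linear maps *)

Section Cayley.
Variables (t : R) (X S S' : V -> V).
Hypotheses (Xr : right_linear X)
  (Xskew : forall x y, omega (X x) y + omega x (X y) = 0)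
  (SK : forall v, S (v - t *: X v) = v)
  (KS : forall v, S v - t *: X (S v) = v)
  (SK' : forall v, S' (v + t *: X v) = v)
  (KS' : forall v, S' v + t *: X (S' v) = v).

(** Here [S] and [S'] are the inverses of [1 - tX] and [1 + tX], so [cayley] is
    [(1 + tX) (1 - tX)^-1] and [cayley_inv] is [(1 - tX) (1 + tX)^-1]. *)
Definition cayley (v : V) : V := S v + t *: X (S v).
Definition cayley_inv (v : V) : V := S' v - t *: X (S' v).

Fact cayleyK : cancel cayley cayley_inv.
Proof. by move=> v; rewrite /cayley /cayley_inv SK' KS. Qed.
Fact cayley_invK : cancel cayley_inv cayley.
Proof. by move=> v; rewrite /cayley /cayley_inv SK KS'. Qed.

Fact cayley_right_linear : right_linear cayley.
Proof.
case: Xr => XD XZ.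
(* [S] inherits additivity and right homogeneity from the map [1 - tX] that it inverts. *)
have SD (v w : V) : S (v + w) = S v + S w.
  rewrite -[RHS]SK XD scalerDr opprD addrACA !KS; reflexivity.
have SZ (v : V) a : S (rscale v a) = rscale (S v) a.
  rewrite -[RHS]SK XZ scale_rscale.
  rewrite -(linear_funN (rscale_linear a)) -rscaleDl KS; reflexivity.
split=> [v w|v a]; rewrite /cayley.
  by rewrite SD XD scalerDr addrACA.
by rewrite SZ XZ scale_rscale -rscaleDl.
Qed.

Fact cayley_omega v w : omega (cayley v) (cayley w) = omega v w.
Proof.
(* With [v] and [w] written as values of [1 - tX], both sides have the same terms of degree 0 and 2
   in [t]; the linear terms cancel by skewness of [X]. *)
rewrite -{2}(KS v) -{2}(KS w) /cayley.
rewrite !(omegaCDl sigma_anti) !omegaCDr.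
rewrite !(omegaCNl sigma_anti) !omegaCNr opprK.
rewrite !addrA; congr (_ + _); rewrite -!addrA; congr (_ + _).
rewrite !omegaC_scaler !(omegaC_scalel sigma_anti) -mulrDl -!mulNr -mulrDl.
by rewrite addrC Xskew -opprD addrC Xskew oppr0.
Qed.

Definition cayley_Sp2 : Sp2 sigma :=
  MkSp2 cayley_right_linear cayleyK cayley_invK cayley_omega.

End Cayley.


Lemma right_linear_scale (r : R) (f : V -> V) : right_linear f ->
  right_linear (fun v => r *: f v : V).
Proof.
move=> [fD fZ]; split=> [v w|v a]; first by rewrite fD scalerDr.
by rewrite fZ scale_rscale.
Qed.

Lemma conj_linear_comp J L : conj_linear J -> conj_linear L ->
  right_linear (fun v => L (J v)).
Proof.
move=> [JD JZ] [LD LZ]; split=> [v w|v a]; first by rewrite JD LD.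
by rewrite JZ LZ cconjK.
Qed.

(** The first summand is minus the conjugate of [omega (J x) (L y)], by symmetry of the form of [L];
    the second is plus that conjugate, by anticommutation and symmetry of the form of [J]. *)
Lemma anticommuting_comp_skew J L :
  bar_symmetric sigma (form_of sigma J) ->
  bar_symmetric sigma (form_of sigma L) ->
  (forall x, L (J x) + J (L x) = 0) ->
  forall x y, omega (L (J x)) y + omega x (L (J y)) = 0.
Proof.
move=> Js Ls LJ x y.
have -> : L (J y) = - J (L y) by apply/eqP; rewrite -addr_eq0 LJ.
have -> : omega (L (J x)) y = bar_sigmaC sigma (omega (L y) (J x)) by exact: Ls.
have -> : omega x (- J (L y)) = cconj (omega (J x) (L y)).
  rewrite omegaC_sym // omegaCNl // (sigmaCN sigma_anti) opprK.
  rewrite [omega (J _) x]Js (sigmaC_bar_sigmaC sigma_anti); reflexivity.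
rewrite [omega (L y) _]omegaC_sym // -(sigmaCN sigma_anti) -omegaCNr.
rewrite (bar_sigmaC_sigmaC sigma_anti) omegaCNr.
by apply: cplx_eq; rewrite /= ?opprK ?addNr // addrC addNr.
Qed.

Lemma tangent_space_sup J L : M J -> conj_linear L ->
  bar_symmetric sigma (form_of sigma L) -> (forall x, L (J x) + J (L x) = 0) ->
  tangent_space M J L.
Proof.
move=> MJ Lc Ls LJ; have [[Jc J2] [Js _]] := MJ.
pose c : R := - 4^-1.
pose X0 (v : V) : V := c *: (L (J v) : V).
have X0r : right_linear X0.
  by apply: right_linear_scale; exact: conj_linear_comp.
have X0skew v w : omega (X0 v) w + omega v (X0 w) = 0.
  rewrite /X0 omegaC_scaler (omegaC_scalel sigma_anti) -mulrDl.
  by rewrite (anticommuting_comp_skew Js Ls LJ) mul0r.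
pose X : {linear V -> V} := linear_map (right_linear_linear X0r).
have XE v : X v = X0 v by [].
have JL : linear (J : V -> V) by exact: conj_linear_linear.
have JX v : J (X v) = - X (J v).
  rewrite !XE /X0 (linear_funZ _ _ JL) -scalerN.
  apply: (congr1 (fun v : V => c *: v)).
  by apply/eqP; rewrite -addr_eq0 addrC LJ.
have [eps e0 [S [SK KS Sr]]] := resolvent X.
pose g t (v : V) : V := S t v + t *: X (S t v).
(* Writing the conjugate of [J] as the square of [g t] after [J] shows directly that the curve is
   rational. *)
pose gamma t (x : V) : V := g t (g t (J x)).
have e0' : `|0 : R| < eps by rewrite normr0.
have S0 v : S 0 v = v by rewrite -{2}(SK 0 v e0') scale0r subr0.
have gr u : rational_curve eps u -> rational_curve eps (fun t => g t (u t)).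
  move=> ru; apply: rational_curveD; first exact: Sr.
  apply: rational_curveZ; first exact: rational_near0_id.
  by apply: rational_curve_linear; exact: Sr.
(* This is [1 + 2tX (1 - tX)^-1], which isolates the factor [t] needed for the velocity. *)
have gE t v : `|t| < eps -> g t v = v + t *: (X (S t v) *+ 2).
  move=> te; rewrite /g -[X in _ = X + _](KS t v te).
  rewrite mulr2n scalerDr addrA subrK; reflexivity.
exists gamma; apply/representsE; exists eps => //; split=> [x psi|t te||x].
- apply: rational_near0_smooth; apply: (gr (fun t => g t (J x))).
  apply: gr; exact: rational_curve_cst.
(* The inverse of [1 + tX] is the resolvent at [- t]. *)
- have te' : `|- t| < eps by rewrite normrN.
  have SK' v : S (- t) (v + t *: X v) = v.
    by have := SK _ v te'; rewrite scaleNr opprK.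
  have KS' v : S (- t) v + t *: X (S (- t) v) = v.
    by have := KS _ v te'; rewrite scaleNr opprK.
  pose G := cayley_Sp2 X0r X0skew
    (fun v => SK t v te) (fun v => KS t v te) SK' KS'.
  suff -> : gamma t = conjugate G J by exact: quaternionic_space_conjugate.
  apply/funext => x; rewrite /gamma /conjugate /=; congr (g t _).
  (* As [J] anticommutes with [X], it exchanges the resolvents at [- t] and [t], hence carries the
     inverse Cayley transform to the transform itself. *)
  have JS v : J (S (- t) v) = S t (J v).
    rewrite -{2}(KS' v) (linear_funD JL) (linear_funZ _ _ JL) JX scalerN.
    by rewrite SK.
  rewrite /cayley_inv (linear_funD JL) (linear_funN JL) (linear_funZ _ _ JL).
  by rewrite -[X0 _]/(X _) JX JS scalerN opprK.
- apply/funext => x; rewrite /gamma !gE // !scale0r !addr0; reflexivity.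
pose w t := g t (J x).
(* Applying [gE] twice gives [gamma t x = J x + t *: d t], so the velocity is [d 0]. *)
pose d t : V := X (S t (J x)) *+ 2 + X (S t (w t)) *+ 2.
have dr : rational_curve eps d.
  have XSr u : rational_curve eps u ->
      rational_curve eps (fun t => X (S t (u t)) *+ 2).
    move=> ru; apply: (rational_curveD (u := fun t => X (S t (u t)))
                         (w := fun t => X (S t (u t))));
      by apply: rational_curve_linear; exact: Sr.
  apply: rational_curveD; apply: (XSr); first exact: rational_curve_cst.
  by apply: gr; exact: rational_curve_cst.
(* At 0 both terms equal [2 X (J x)], and their sum is [4 c L (J (J x)) = - 4 c L x]; this is what
   forces [c = - 1/4]. *)
have -> : L x = d 0.
  rewrite /d /w gE // scale0r addr0 S0 -mulrnDr XE /X0 J2.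
  rewrite (linear_funN (conj_linear_linear Lc)) scalerN -[(2 + 2)%N]/4%N.
  by rewrite -scaleNr opprK -scaler_nat scalerA divff ?scale1r // pnatr_eq0.
move=> psi; have dd := rational_has_velocity (J x : V) e0 dr psi.
refine (near_eq_is_derive _ dd).
apply: near_ball0 e0' _ => t te; congr (psi _).
rewrite /gamma -/(w t) (gE _ (w t)) // {1}/w gE // -addrA -scalerDr.
reflexivity.
Qed.

End TangentSpace.

(* The third clause identifies the conjugation action as the action on the
   tangent bundle induced by the action on the base: conjugating a curve with
   velocity L at J gives a curve with velocity g L g^-1 at g J g^-1. *)
Theorem proposition7p2 (R : realType) (A : falgType R) (sigma : A -> A) :
  hermitian_algebra sigma ->
  [/\ (forall J, quaternionic_space sigma J ->
         tangent_space (quaternionic_space sigma) J =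
         [set L | [/\ conj_linear L,
                      bar_symmetric sigma (form_of sigma L)
                    & forall x, L (J x) + J (L x) = 0]]),
      acts_on (@conjugate_pair R A sigma)
        (tangent_bundle (quaternionic_space sigma)),
      (forall (g : Sp2 sigma) J L gamma,
         represents (quaternionic_space sigma) J L gamma ->
         represents (quaternionic_space sigma)
           (conjugate g J) (conjugate g L) (fun t => conjugate g (gamma t)))
    & (forall (g : Sp2 sigma) J, quaternionic_space sigma J ->
         tangent_space (quaternionic_space sigma) (conjugate g J) =
         [set conjugate g L
            | L in tangent_space (quaternionic_space sigma) J])].
Proof.
move=> [_ sigma_anti _]; split=> [J MJ||g J L gamma|g J _].
- rewrite eqEsubset; split=> [L|L [Lc Ls LJ]]; first exact: tangent_space_sub.
  exact: tangent_space_sup.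
- split=> [g [J L] [/= MJ TL]|[J L] _|g h [J L] _].
  + split; first exact: quaternionic_space_conjugate.
    exact: tangent_space_conjugate_sub.
  + by rewrite /conjugate_pair !conjugate1.
  + by rewrite /conjugate_pair !conjugateM.
- exact: represents_conjugate.
- exact: tangent_space_conjugate.
Qed.
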